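(* Let $\Gamma\subset \mathrm{SL}(2,\mathbb R)$ be a Fuchsian group of the first kind with a cusp at $\infty$ (scaling matrix $\sigma_\infty=I$), let $0\not\equiv f\in S_2(\Gamma)$, let $\mathfrak a$ be any cusp, and let $S_{\mathfrak a},S^*_{\mathfrak a}:\Gamma\to\mathbb R$ be the modular Dedekind symbol and the higher-order modular Dedekind symbol (associated to $f$). Then for all $\gamma_1,\gamma_2,\gamma_3\in\Gamma$: $$S^*_{\mathfrak a}(\gamma_1\gamma_2\gamma_3)-S^*_{\mathfrak a}(\gamma_1\gamma_2)-S^*_{\mathfrak a}(\gamma_1\gamma_3)-S^*_{\mathfrak a}(\gamma_2\gamma_3)+S^*_{\mathfrak a}(\gamma_1)+S^*_{\mathfrak a}(\gamma_2)+S^*_{\mathfrak a}(\gamma_3)=\omega(\gamma_1\gamma_2,\gamma_3)-\omega(\gamma_1,\gamma_3)-\omega(\gamma_2,\gamma_3).$$ Consequently, with $\equiv$ denoting equality in $\mathbb R/\mathbb Z$, $$S_{\mathfrak a}(\gamma_1\gamma_2)\equiv S_{\mathfrak a}(\gamma_1)+S_{\mathfrak a}(\gamma_2),$$ $$S^*_{\mathfrak a}(\gamma_1\gamma_2\gamma_3)\equiv S^*_{\mathfrak a}(\gamma_1\gamma_2)+S^*_{\mathfrak a}(\gamma_1\gamma_3)+S^*_{\mathfrak a}(\gamma_2\gamma_3)-S^*_{\mathfrak a}(\gamma_1)-S^*_{\mathfrak a}(\gamma_2)-S^*_{\mathfrak a}(\gamma_3),$$ so that $S_{\mathfrak a}:\Gamma\to\mathbb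 R/\mathbb Z$ is a homomorphism. Moreover $\theta_{\mathfrak a}:=S^*_{\mathfrak a}-S_{\mathfrak a}$ satisfies $$\theta_{\mathfrak a}(\gamma_1\gamma_2\gamma_3)=\theta_{\mathfrak a}(\gamma_1\gamma_2)+\theta_{\mathfrak a}(\gamma_1\gamma_3)+\theta_{\mathfrak a}(\gamma_2\gamma_3)-\theta_{\mathfrak a}(\gamma_1)-\theta_{\mathfrak a}(\gamma_2)-\theta_{\mathfrak a}(\gamma_3).$$
   Context: Write $z=x+iy\in\mathbb H$ (upper half plane), $e(z)=e^{2\pi i z}$, $j(\gamma,z)=cz+d$ for $\gamma=\begin{pmatrix}a&b\\c&d\end{pmatrix}$; $\log$ is the principal branch with argument in $(-\pi,\pi]$. $\Gamma$ is a Fuchsian group of the first kind, $V_\Gamma$ is the (finite) hyperbolic volume of $\Gamma\backslash\mathbb H$ with respect to $dx\,dy/y^2$, with at least one cusp; $\Gamma$ is conjugated so that $\infty$ is a cusp with $\sigma_\infty=I$. For a cusp $\mathfrak a$, $\Gamma_{\mathfrak a}$ is its stabilizer in $\Gamma$ and a scaling matrix $\sigma_{\mathfrak a}\in\mathrm{SL}(2,\mathbb R)$ satisfies $\sigma_{\mathfrak a}\infty=\mathfrak a$ and $\sigma_{\mathfrak a}^{-1}\Gamma_{\mathfrak a}\sigma_{\mathfrak a}=\{\pm\begin{pmatrix}1&m\\0&1\end{pmatrix}: m\in\mathbb Z\}$ (up to $\pm I$). Put $\delta_{\mathfrak a\mathfrak b}=1$ if $\mathfrak a,\mathfrak b$ represent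 the same cusp and $0$ otherwise. $S_2(\Gamma)$ is the space of holomorphic weight $2$ cusp forms, $\|f\|^2=\int_{\Gamma\backslash\mathbb H}|f(z)|^2\,dx\,dy$, $\langle\gamma,f\rangle:=2\pi i\int_{z_0}^{\gamma z_0}f(w)\,dw$ (independent of $z_0\in\mathbb H$), $F_{\mathfrak a}(z):=2\pi i\int_{\mathfrak a}^z f(w)\,dw$, and $V_f:=V_\Gamma/(16\pi^2\|f\|^2)$. For $m\ge0$, $E^{m,m}_{\mathfrak a}(z,s)=\sum_{\gamma\in\Gamma_{\mathfrak a}\backslash\Gamma}|\langle\gamma,f\rangle|^{2m}\,\mathrm{Im}(\sigma_{\mathfrak a}^{-1}\gamma z)^s$ for $\mathrm{Re}(s)>1$ (with $E^{0,0}_{\mathfrak a}$ the usual untwisted series), continued meromorphically in $s$. With $A_m:=\frac{(16\pi^2)^m}{V_\Gamma^{m+1}}m!^2\|f\|^{2m}$ one has $\frac1{A_m}E^{m,m}_{\mathfrak a}(z,s)=\frac1{(s-1)^{m+1}}+\frac{B^{(m)}_{\mathfrak a}(z)}{(s-1)^m}+O\bigl((s-1)^{1-m}\bigr)$ as $s\to1$, defining $B^{(m)}_{\mathfrak a}$. There is an expansion $B^{(m)}_{\mathfrak a}(z)=-\log y+b^{(m)}_{\mathfrak a}(0)+2\,\mathrm{Re}\,H^{(m)}_{\mathfrak a}(z)$ with $b^{(m)}_{\mathfrak a}(0)\in\mathbb R$ and $H^{(m)}_{\mathfrak a}(z)=-\delta_{0m}\delta_{\mathfrak a\infty}V_\Gamma\,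 iz/2+\sum_{k\ge1}b^{(m)}_{\mathfrak a}(k)e(kz)$ holomorphic on $\mathbb H$. For $m\ge1$, $H^{(m)}_{\mathfrak a}$ is independent of $m$ and denoted $H^*_{\mathfrak a}$. The real-valued symbols are defined (independently of $z\in\mathbb H$) by $$H^{(0)}_{\mathfrak a}(\gamma z)-H^{(0)}_{\mathfrak a}(z)=-\log j(\gamma,z)-2\pi i S_{\mathfrak a}(\gamma),$$ $$H^*_{\mathfrak a}(\gamma z)-H^*_{\mathfrak a}(z)=-\log j(\gamma,z)+V_f\bigl(F_{\mathfrak a}(z)\overline{\langle\gamma,f\rangle}+|\langle\gamma,f\rangle|^2/2\bigr)-2\pi i S^*_{\mathfrak a}(\gamma).$$ Phase factor: for $M,N\in\mathrm{SL}(2,\mathbb R)$, $\omega(M,N):=\frac{1}{2\pi i}\bigl(-\log j(MN,z)+\log j(M,Nz)+\log j(N,z)\bigr)\in\{-1,0,1\}$, independent of $z\in\mathbb H$. *)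

(* Defs.v *)
From HB Require Import structures.
From mathcomp Require Import all_boot all_order all_algebra.
From mathcomp Require Import complex.
From mathcomp Require Import all_classical all_reals all_analysis.
From mathcomp.analysis.showcase Require summability.

Set Implicit Arguments.
Unset Strict Implicit.
Unset Printing Implicit Defensive.

Import Order.TTheory GRing.Theory Num.Theory.
Import numFieldNormedType.Exports.

Local Open Scope classical_set_scope.
Local Open Scope ring_scope.
Local Open Scope complex_scope.

(* MathComp-Analysis puts the norm topology of a number field K on K^o only;
   this transports it to the complex numbers R[i].  In particular, for
   f : R[i] -> R[i], [derivable f z 1] is complex differentiability at z. *)
HB.instance Definition _ (R : realType) := NormedModule.copy R[i] R[i]^o.

Section ComplexFunctions.
Variable R : realType.
Implicit Types (z w s : R[i]) (f : R[i] -> R[i]).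

Definition cabs z : R := ComplexField.Normc.normc z.

Definition cexp z : R[i] :=
  (expR (complex.Re z))%:C * (cos (complex.Im z) +i* sin (complex.Im z)).

(* e(z) = exp (2 pi i z) *)
Definition e z : R[i] := cexp (2 * pi%:C * 'i * z).

(* Principal argument, in ]-pi, pi]; on the negative real axis it is pi. *)
Definition carg z : R :=
  let t := acos (complex.Re z / cabs z) in
  if 0 <= complex.Im z then t else - t.

Definition clog z : R[i] := ln (cabs z) +i* carg z.

(* y ^ s, for a real y > 0 *)
Definition cpow (y : R) s : R[i] := cexp (s * (ln y)%:C).

Definition upper_half_plane : set R[i] := [set z | 0 < complex.Im z].

Definition holomorphic_on (D : set R[i]) f : Prop :=
  forall z, D z -> derivable f z 1.

(* Near every point p, g agrees off p with h / (s - p)^n, h holomorphic at p;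
   the value of g at a pole is irrelevant. *)
Definition meromorphic (g : R[i] -> R[i]) : Prop :=
  forall p : R[i], exists n : nat, exists h : R[i] -> R[i],
    (\forall s \near p, derivable h s 1) /\
    (\forall s \near p^', g s = h s / (s - p) ^+ n).

(* Integral of f along the segment from z to w; the upper half plane is
   convex, so that for f holomorphic there this is the integral of f along any
   path from z to w. *)
Definition line_integral f z w : R[i] :=
  let g := fun t : R => f (z + t%:C * (w - z)) in
  (w - z) * ((\int[lebesgue_measure]_(t in `[0, 1]) complex.Re (g t)) +i*
             (\int[lebesgue_measure]_(t in `[0, 1]) complex.Im (g t))).

End ComplexFunctions.

Section Groups.
Variable R : realType.
Implicit Types (g M N sigma : 'M[R]_2) (z : R[i]) (G : set 'M[R]_2).

Local Notation HH := (@upper_half_plane R).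

Definition jfactor g z : R[i] := (g 1 0)%:C * z + (g 1 1)%:C.

Definition moebius g z : R[i] :=
  ((g 0 0)%:C * z + (g 0 1)%:C) / jfactor g z.

(* The phase factor does not depend on z in the upper half plane: it is
   evaluated at z = i. *)
Definition omega M N : R[i] :=
  (- clog (jfactor (M *m N) 'i) + clog (jfactor M (moebius N 'i))
   + clog (jfactor N 'i)) / (2 * pi%:C * 'i).

(* The boundary R \cup {oo} of the upper half plane is [option R], with None
   standing for oo. *)
Definition boundary_act g (a : option R) : option R :=
  match a with
  | None => if g 1 0 == 0 then None else Some (g 0 0 / g 1 0)
  | Some x => if g 1 0 * x + g 1 1 == 0 then None
              else Some ((g 0 0 * x + g 0 1) / (g 1 0 * x + g 1 1))
  end.

Definition boundary_limit_point G (a : option R) : Prop :=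
  exists2 z, HH z &
    match a with
    | Some x => closure [set moebius g z | g in G] (x%:C)
    | None => forall B : R, exists2 g, G g & B < cabs (moebius g z)
    end.

Record fuchsian_first_kind G : Prop := {
  fuchsian_det : forall g, G g -> \det g = 1;
  fuchsian_one : G 1%:M;
  fuchsian_mul : forall g h, G g -> G h -> G (g *m h);
  fuchsian_inv : forall g, G g -> G (invmx g);
  fuchsian_discrete : G `<=` isolated G;
  fuchsian_limit : forall a, boundary_limit_point G a }.

Definition stabilizer G (a : option R) : set 'M[R]_2 :=
  [set g | G g /\ boundary_act g a = a].

Definition parabolic g : Prop :=
  [/\ `|\tr g| = 2, g <> 1%:M & g <> - 1%:M].

Definition is_cusp G (a : option R) : Prop :=
  exists2 g, stabilizer G a g & parabolic g.

Definition same_cusp G (a b : option R) : Prop :=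
  exists2 g, G g & boundary_act g a = b.

Definition translation (m : int) : 'M[R]_2 := 1%:M + m%:~R *: delta_mx 0 1.

(* Equality up to sign: -1 may or may not belong to G. *)
Definition scaling_matrix G (a : option R) sigma : Prop :=
  [/\ \det sigma = 1, boundary_act sigma None = a
    & [set h | exists2 g, stabilizer G a g &
         h = invmx sigma *m g *m sigma \/ h = - (invmx sigma *m g *m sigma)]
      = [set h | exists m : int, h = translation m \/ h = - translation m]].

Definition plane : Type := (measurableTypeR R * measurableTypeR R)%type.

(* A Borel set, in real coordinates (x, y), with exactly one point in each
   G-orbit of the upper half plane. *)
Definition is_fundamental_domain G (F : set plane) : Prop :=
  [/\ measurable (F : set (measurableTypeR R * measurableTypeR R)),
      forall p, F p -> HH (p.1 +i* p.2)
    & forall z, HH z ->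
        exists! p, F p /\ exists2 g, G g & moebius g z = p.1 +i* p.2].

Definition fundamental_domain G : set plane :=
  xget set0 [set F | is_fundamental_domain G F].

(* Hyperbolic volume of the quotient of the upper half plane by G *)
Definition covolume G : \bar R :=
  (\int[(@lebesgue_measure R \x @lebesgue_measure R)]_(p in
      fundamental_domain G) (p.2 ^- 2)%:E)%E.

Definition volume G : R := fine (covolume G).

Record cusp_form2 G (f : R[i] -> R[i]) : Prop := {
  cusp_form2_holomorphic : holomorphic_on HH f;
  cusp_form2_automorphic : forall g z, G g -> HH z ->
    f (moebius g z) = jfactor g z ^+ 2 * f z;
  cusp_form2_fourier : forall b sigma, is_cusp G b -> scaling_matrix G b sigma ->
    exists c : nat -> R[i], forall z, HH z ->
      series (fun n : nat => c n.+1 * e (n.+1%:R * z)) @ \oo -->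
        jfactor sigma z ^- 2 * f (moebius sigma z) }.

(* The square of the Petersson norm *)
Definition petersson2 G (f : R[i] -> R[i]) : R :=
  \int[(@lebesgue_measure R \x @lebesgue_measure R)%E]_(p in
      fundamental_domain G) (cabs (f (p.1 +i* p.2)) ^+ 2).

(* <g, f>, with base point i *)
Definition modular_symbol (f : R[i] -> R[i]) g : R[i] :=
  2 * pi%:C * 'i * line_integral f 'i (moebius g 'i).

(* F_a(z), a the cusp with scaling matrix sigma: the integral from a is the
   limit of the integral from sigma (i y) as y -> +oo. *)
Definition cusp_integral (f : R[i] -> R[i]) sigma z : R[i] :=
  2 * pi%:C * 'i *
    lim (line_integral f (moebius sigma (0 +i* y)) z @[y --> +oo]).

Definition V_f G f : R := volume G / (16 * pi ^+ 2 * petersson2 G f).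

(* The coset space G_a \ G, as a set of subsets of G *)
Definition stab_cosets G (a : option R) : set (set 'M[R]_2) :=
  [set K | exists2 g, G g & K = [set p *m g | p in stabilizer G a]].

(* The summand at the coset K, evaluated at an arbitrary representative. *)
Definition eisenstein_term G f (m : nat) a sigma z (s : R[i])
    (K : set 'M[R]_2) : R[i] :=
  if K \in stab_cosets G a then
    let g := xget 1%:M K in
    (cabs (modular_symbol f g) ^+ (2 * m))%:C
      * cpow (complex.Im (moebius (invmx sigma *m g) z)) s
  else 0.

(* E z is the meromorphic continuation to R[i] of E^{m,m}_a(z, .); the
   defining series is an unordered sum over G_a \ G. *)
Definition eisenstein_continuation G f m a sigma
    (E : R[i] -> R[i] -> R[i]) : Prop :=
  forall z, HH z -> meromorphic (E z) /\
    forall s, 1 < complex.Re s ->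
      summability.partial_sum (eisenstein_term G f m a sigma z s)
        @ summability.totally --> E z s.

Definition A_coef G f (m : nat) : R :=
  (16 * pi ^+ 2) ^+ m / volume G ^+ m.+1 * m`!%:R ^+ 2 * petersson2 G f ^+ m.

(* B is the coefficient B^{(m)}_a of the Laurent expansion at s = 1. *)
Definition kronecker_coef G f m a sigma (B : R[i] -> R) : Prop :=
  exists2 E, eisenstein_continuation G f m a sigma E &
    forall z, HH z ->
      (fun s : R[i] => E z s / (A_coef G f m)%:C
         - ((s - 1) ^- m.+1 + (B z)%:C / (s - 1) ^+ m))
      =O_ (dnbhs (1 : R[i])) (fun s : R[i] => (s - 1) ^ (1 - m%:Z)).

(* H is the function H^{(m)}_a: it is determined on the upper half plane,
   since its Fourier expansion has no constant term. *)
Definition kronecker_function G f m a sigma (H : R[i] -> R[i]) : Prop :=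
  exists2 B, kronecker_coef G f m a sigma B &
  exists b0 : R, exists b : nat -> R[i],
  [/\ holomorphic_on HH H,
      forall z, HH z ->
        B z = - ln (complex.Im z) + b0 + 2 * complex.Re (H z)
    & forall z, HH z ->
        series (fun k : nat => b k.+1 * e (k.+1%:R * z)) @ \oo -->
        H z + (if (m == 0%N) && `[< same_cusp G a None >]
               then (volume G)%:C * 'i * z / 2 else 0)].

(* The form f plays no role here, as m = 0. *)
Definition modular_dedekind_symbol G f a sigma (S : 'M[R]_2 -> R) : Prop :=
  exists2 H, kronecker_function G f 0 a sigma H &
    forall g z, G g -> HH z ->
      H (moebius g z) - H z
      = - clog (jfactor g z) - 2 * pi%:C * 'i * (S g)%:C.

(* H^*_a is H^{(m)}_a for any m >= 1: these functions do not depend on m. *)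
Definition higher_dedekind_symbol G f a sigma (S : 'M[R]_2 -> R) : Prop :=
  exists2 H, (exists2 m : nat, (1 <= m)%N & kronecker_function G f m a sigma H) &
    forall g z, G g -> HH z ->
      H (moebius g z) - H z
      = - clog (jfactor g z)
        + (V_f G f)%:C * (cusp_integral f sigma z * (modular_symbol f g)^*
                          + (cabs (modular_symbol f g) ^+ 2 / 2)%:C)
        - 2 * pi%:C * 'i * (S g)%:C.

End Groups.

(* Equality in R / Z *)
Definition eq_mod1 (R : realType) (x y : R) : Prop := x - y \is a Num.int.

(* Main.v *)
Require Import Defs.
From mathcomp Require Import all_boot all_order all_algebra.
From mathcomp Require Import complex.
From mathcomp Require Import all_classical all_reals all_analysis.
From mathcomp Require Import ring lra.
Import Order.TTheory GRing.Theory Num.Theory.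
Import numFieldNormedType.Exports.
Import ComplexField.
Local Open Scope classical_set_scope.
Local Open Scope ring_scope.
Local Open Scope complex_scope.
Set Implicit Arguments.
Unset Strict Implicit.
Unset Printing Implicit Defensive.

(** Let [m_g] be the period of [f] along [g], let [V] be [V_f G f], and let [H]
be the function that defines the higher-order symbol. Decompose
[H (MNz) - H z] as [(H (MNz) - H (Nz)) + (H (Nz) - H z)] and use the functional
equation for each difference. The logarithms combine into [omega M N]. Since
the period is additive, [m_(MN) = m_M + m_N], and since [F (Nz) = F z + m_N],
the terms that contain [F] cancel and there remains
[Sstar (MN) - Sstar M - Sstar N = omega M N + B (m_M, m_N)],
where [B] is [V / (2 pi)] times the imaginary part of [m_M * m_N^*]
([higher_dedekind_cocycle]). The same computation without [f] gives
[S (MN) - S M - S N = omega M N] ([dedekind_cocycle]). As [B] is biadditive, it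
disappears from the combination
[D (g1g2, g3) - D (g1, g3) - D (g2, g3)] of the defects
[D (M, N) = Sstar (MN) - Sstar M - Sstar N], and this is the first identity; the congruences follow since [omega] takes integral values
([omega_int]); and the difference of the two symbols has defect [B], so that it
is quadratic.

The analytic content is the additivity of the periods and the relation
[F (Nz) = F z + m_N], together with the existence of the limit that defines [F].
All of this follows from a global primitive of [f]. Such a primitive is
obtained without Cauchy's theorem: the Fourier expansion of [f] at infinity is a
power series in [q = e z] that converges on the whole unit disc, and it can be
integrated term by term ([power_series_primitive], [fourier_primitive]). By the
fundamental theorem of calculus line integrals of [f] are differences of the
primitive ([line_integral_primitive]). A function with zero derivative on the
upper half plane is constant, so that the weight 2 automorphy makes the change
of the primitive under an element of [G] constant ([automorphic_primitive]); and
comparison with the expansion at the cusp [a] gives the limit at that cusp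
([line_integral_cusp_cvg]). *)

(** * Modulus, limits and derivatives in the complex plane *)

Lemma is_derive1_chain (K : numFieldType) (F G : K -> K) (z a b : K) :
  is_derive (F z) 1 G a -> is_derive z 1 F b -> is_derive z 1 (G \o F) (a * b).
Proof.
move=> [/derivable1_diffP dG <-] [/derivable1_diffP dF <-].
have dGF := differentiable_comp dF dG.
apply: DeriveDef; first exact: diff_derivable.
rewrite (deriveE _ dGF) diff_comp //= (deriveE _ dG) (deriveE _ dF) mulrC.
by rewrite -[X in 'd G _ X = _]mulr1 [LHS]linearZ.
Qed.

(** Little-o form of the derivative; the quotient by the increment is absent, so
that the increment 0 needs no separate treatment in estimates. *)
Lemma is_derive1P (K : numFieldType) (F : K -> K) (z l : K) :
  is_derive z 1 F l <-> forall d : K, 0 < d ->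
    \forall h \near 0, `|F (h + z) - F z - l * h| <= d * `|h|.
Proof.
have alg (D A k : K) : k != 0 -> D - k^-1 * A = - (k^-1 * (A - D * k)).
  by move=> k0; field.
split=> [[dF <-] d d0|H].
  have : h^-1 *: (F (h *: 1 + z) - F z) @[h --> 0^'] --> 'D_1 F z := dF.
  move=> /cvgrPdist_le /(_ d d0); rewrite near_withinE.
  apply: filterS => h Hh.
  have [->|h0] := eqVneq h 0.
    by rewrite add0r subrr mulr0 subr0 normr0 mulr0.
  move: (Hh h0); rewrite [h *: 1]mulr1 [_ *: _]/(_ * _) alg //.
  by rewrite normrN normrM normfV mulrC ler_pdivrMr ?normr_gt0.
have K1 : h^-1 *: (F (h *: 1 + z) - F z) @[h --> 0^'] --> l.
  apply/cvgrPdist_le => d d0; rewrite near_withinE.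
  apply: filterS (H _ d0) => h + h0.
  rewrite [h *: 1]mulr1 [_ *: _]/(_ * _) alg // => Hh.
  by rewrite normrN normrM normfV mulrC ler_pdivrMr ?normr_gt0.
apply: DeriveDef; first by apply: cvgP K1.
exact: cvg_lim K1.
Qed.

Section ComplexTopology.
Variable R : realType.
Implicit Types (z w : R[i]) (F : R[i] -> R[i]).

Lemma normrC z : `|z| = (cabs z)%:C.
Proof. by []. Qed.

Lemma cabsE z : cabs z = Num.sqrt (complex.Re z ^+ 2 + complex.Im z ^+ 2).
Proof. by case: z. Qed.

Lemma cabs_ge0 z : 0 <= cabs z.
Proof. by rewrite cabsE sqrtr_ge0. Qed.

Lemma cabs0 : cabs 0 = 0 :> R.
Proof. exact: Normc.normc0. Qed.

Lemma cabs1 : cabs 1 = 1 :> R.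
Proof. exact: Normc.normc1. Qed.

Lemma cabsM z w : cabs (z * w) = cabs z * cabs w.
Proof. exact: Normc.normcM. Qed.

Lemma cabsV z : cabs z^-1 = (cabs z)^-1.
Proof. exact: Normc.normcV. Qed.

Lemma cabsX z n : cabs (z ^+ n) = cabs z ^+ n.
Proof. by elim: n => [|n IH]; rewrite ?expr0 ?cabs1 // !exprS cabsM IH. Qed.

Lemma cabsD z w : cabs (z + w) <= cabs z + cabs w.
Proof. exact: le_normcD. Qed.

Lemma cabsN z : cabs (- z) = cabs z.
Proof. exact: normcN. Qed.

Lemma cabs_eq0 z : (cabs z == 0) = (z == 0).
Proof. by apply/eqP/eqP => [/Normc.eq0_normc|->]; rewrite ?cabs0. Qed.

Lemma cabs_gt0 z : (0 < cabs z) = (z != 0).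
Proof. by rewrite lt_def cabs_ge0 andbT cabs_eq0. Qed.

Lemma cabs_real (x : R) : cabs x%:C = `|x|.
Proof. by rewrite cabsE /= expr0n addr0 sqrtr_sqr. Qed.

Lemma normRe_le z : `|complex.Re z| <= cabs z.
Proof. by have := normc_ge_Re z; rewrite normrC lecR. Qed.

Lemma normIm_le z : `|complex.Im z| <= cabs z.
Proof.
rewrite cabsE -sqrtr_sqr ler_wsqrtr //.
by rewrite lerDr sqr_ge0.
Qed.

Lemma cabs_le z : cabs z <= `|complex.Re z| + `|complex.Im z|.
Proof.
have {1}-> : z = (complex.Re z)%:C + 'i * (complex.Im z)%:C by exact: complexE.
apply: le_trans (cabsD _ _) _.
rewrite cabs_real cabsM cabs_real.
by rewrite cabsE /= expr0n add0r expr1n sqrtr1 mul1r.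
Qed.

Lemma cabsMn z n : cabs (z *+ n) = cabs z *+ n.
Proof. exact: normcMn. Qed.

Lemma cabs_nat n : cabs n%:R = n%:R :> R.
Proof. by rewrite -(rmorph_nat (real_complex R)) cabs_real ger0_norm. Qed.

Lemma cabs_sum n (F : 'I_n -> R[i]) : cabs (\sum_i F i) <= \sum_i cabs (F i).
Proof.
apply: (big_ind2 (fun x y => cabs x <= y)) => //; first by rewrite cabs0.
by move=> x1 x2 y1 y2 H1 H2; rewrite (le_trans (cabsD _ _)) // lerD.
Qed.

Lemma Re_realM (x : R) z : complex.Re (x%:C * z) = x * complex.Re z.
Proof. by case: z => a b /=; ring. Qed.

Lemma ImRe z : complex.Im z = complex.Re (z * - 'i).
Proof. by case: z => a b /=; ring. Qed.

Lemma cabs_sqr z : (cabs z ^+ 2)%:C = z * z^*.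
Proof. by rewrite -sqr_normc normrC rmorphXn. Qed.

Lemma gt0_complex (d : R[i]) : 0 < d -> exists2 r : R, 0 < r & d = r%:C.
Proof.
case: d => a b; rewrite ltcE /= => /andP[/eqP -> a0].
by exists a.
Qed.

(** The norm of R[i] takes its values in R[i], and the radii of its balls are
positive elements of R[i]; these are the positive reals, so that convergence
can be tested on the real-valued modulus. *)
Lemma cvg_cabsP (T : Type) (FF : set_system T) {FFF : Filter FF}
    (u : T -> R[i]) (l : R[i]) :
  u @ FF --> l <-> forall d : R, 0 < d -> \forall x \near FF, cabs (l - u x) < d.
Proof.
split=> [/cvgrPdist_lt H d d0|H].
  have := H d%:C; rewrite ltcR => /(_ d0).
  by apply: filterS => x; rewrite normrC ltcR.
apply/cvgrPdist_lt => d /gt0_complex[r r0 ->].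
by apply: filterS (H r r0) => x; rewrite normrC ltcR.
Qed.

Lemma cvg0_cabs (T : Type) (FF : set_system T) {FFF : Filter FF} (u : T -> R[i]) :
  (forall d : R, 0 < d -> \forall x \near FF, cabs (u x) < d) ->
  u @ FF --> (0 : R[i]).
Proof.
move=> H; apply/cvg_cabsP => d /H.
by apply: filterS => x; rewrite sub0r cabsN.
Qed.

Lemma near0_cabs (d : R) : 0 < d -> \forall h \near (0 : R[i]), cabs h < d.
Proof.
move=> d0; have /cvg_cabsP/(_ d d0) : h @[h --> (0 : R[i])] --> (0 : R[i]).
  exact: cvg_id.
by apply: filterS => h; rewrite sub0r cabsN.
Qed.

Lemma cvg_real (T : Type) (FF : set_system T) {FFF : Filter FF}
    (u : T -> R) (l : R) :
  u @ FF --> l -> (u x)%:C @[x --> FF] --> l%:C.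
Proof.
move=> /cvgrPdist_lt H; apply/cvg_cabsP => d /H.
by apply: filterS => x; rewrite -rmorphB cabs_real.
Qed.

Lemma cvg_Re (T : Type) (FF : set_system T) {FFF : Filter FF}
    (u : T -> R[i]) (l : R[i]) :
  u @ FF --> l -> complex.Re (u x) @[x --> FF] --> complex.Re l.
Proof.
move=> /cvg_cabsP H; apply/cvgrPdist_lt => d /H.
apply: filterS => x; apply: le_lt_trans.
by rewrite (le_trans _ (normRe_le _)) // raddfB.
Qed.

Lemma cvg_Im (T : Type) (FF : set_system T) {FFF : Filter FF}
    (u : T -> R[i]) (l : R[i]) :
  u @ FF --> l -> complex.Im (u x) @[x --> FF] --> complex.Im l.
Proof.
move=> /cvg_cabsP H; apply/cvgrPdist_lt => d /H.
apply: filterS => x; apply: le_lt_trans.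
by rewrite (le_trans _ (normIm_le _)) // raddfB.
Qed.

Lemma cvg_complex (T : Type) (FF : set_system T) {FFF : Filter FF}
    (u : T -> R[i]) (l : R[i]) :
  complex.Re (u x) @[x --> FF] --> complex.Re l ->
  complex.Im (u x) @[x --> FF] --> complex.Im l -> u @ FF --> l.
Proof.
move=> /cvgrPdist_lt HR /cvgrPdist_lt HI; apply/cvg_cabsP => d d0.
have d20 : 0 < d / 2 by rewrite divr_gt0.
near=> x.
rewrite (splitr d) (le_lt_trans (cabs_le _)) // !raddfB /=.
rewrite ltrD //; first by near: x; exact: HR.
by near: x; exact: HI.
Unshelve. all: by end_near. Qed.

Lemma cvg_cabs (T : Type) (FF : set_system T) {FFF : Filter FF}
    (u : T -> R[i]) (l : R[i]) :
  u @ FF --> l -> cabs (u x) @[x --> FF] --> cabs l.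
Proof.
move=> /cvg_cabsP H; apply/cvgrPdist_lt => d /H.
apply: filterS => x; apply: le_lt_trans.
have H1 := cabsD (l - u x) (u x); have H2 := cabsD (u x - l) l.
rewrite !subrK -(opprB l) cabsN in H1 H2.
rewrite ler_norml; lra.
Qed.

Lemma cvgC_unique (T : Type) (FF : set_system T) {FFF : ProperFilter FF}
    (u : T -> R[i]) (l l' : R[i]) :
  u @ FF --> l -> u @ FF --> l' -> l = l'.
Proof. exact: norm_cvg_unique. Qed.

Lemma is_derive_continuous F z l : is_derive z 1 F l -> {for z, continuous F}.
Proof.
by move=> [d _]; apply: differentiable_continuous; apply/derivable1_diffP.
Qed.

(** The chain rule at the structures that [derivable] infers on R[i], so that
their comparison with those of a field over itself is made only here. *)
Lemma is_derive_chain (F G : R[i] -> R[i]) z (a b : R[i]) :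
  is_derive (F z) 1 G a -> is_derive z 1 F b -> is_derive z 1 (G \o F) (a * b).
Proof.
exact: is_derive1_chain.
Qed.

Lemma is_deriveP F z (l : R[i]) : is_derive z 1 F l <->
  forall d : R, 0 < d -> \forall h \near (0 : R[i]),
    cabs (F (h + z) - F z - l * h) <= d * cabs h.
Proof.
rewrite is_derive1P; split=> H d.
  by move=> d0; have := H d%:C; rewrite ltcR => /(_ d0);
    apply: filterS => h; rewrite !normrC -rmorphM lecR.
move=> /gt0_complex[r r0 ->].
by apply: filterS (H r r0) => h; rewrite !normrC -rmorphM lecR.
Qed.
End ComplexTopology.

(** * The complex exponential *)

Section ComplexExponential.
Variable R : realType.
Implicit Types (z w h : R[i]).

Lemma cexpE (x y : R) : cexp (x +i* y) = (expR x * cos y) +i* (expR x * sin y).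
Proof.
rewrite /cexp /=; apply/eqP; rewrite eq_complex /=.
by apply/andP; split; apply/eqP; ring.
Qed.

Lemma cexp0 : cexp 0 = 1 :> R[i].
Proof. by rewrite cexpE expR0 cos0 sin0 mulr1 mulr0. Qed.

Lemma cexpD z w : cexp (z + w) = cexp z * cexp w.
Proof.
case: z w => [x y] [x' y'].
have -> : (x +i* y) + (x' +i* y') = (x + x') +i* (y + y') :> R[i] by [].
rewrite !cexpE expRD cosD sinD.
by apply/eqP; rewrite eq_complex /=; apply/andP; split; apply/eqP; ring.
Qed.

Lemma cexpMn n z : cexp (n%:R * z) = cexp z ^+ n.
Proof.
elim: n => [|n IH]; first by rewrite mul0r cexp0 expr0.
by rewrite -natr1 mulrDl mul1r cexpD IH exprSr.
Qed.

Lemma cabs_cexp z : cabs (cexp z) = expR (complex.Re z).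
Proof.
case: z => x y; rewrite cexpE cabsE /= !exprMn -mulrDr cos2Dsin2 mulr1.
by rewrite sqrtr_sqr ger0_norm // expR_ge0.
Qed.

Lemma cexp_neq0 z : cexp z != 0.
Proof. by rewrite -cabs_gt0 cabs_cexp expR_gt0. Qed.

Lemma near0_Re (P : R -> Prop) :
  (\forall x \near (0 : R), P x) -> \forall h \near (0 : R[i]), P (complex.Re h).
Proof.
have : complex.Re h @[h --> (0 : R[i])] --> complex.Re (0 : R[i]).
  exact: (@cvg_Re R _ (nbhs (0 : R[i])) _ id 0 (@cvg_id _ _)).
exact.
Qed.

Lemma near0_Im (P : R -> Prop) :
  (\forall x \near (0 : R), P x) -> \forall h \near (0 : R[i]), P (complex.Im h).
Proof.
have : complex.Im h @[h --> (0 : R[i])] --> complex.Im (0 : R[i]).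
  exact: (@cvg_Im R _ (nbhs (0 : R[i])) _ id 0 (@cvg_id _ _)).
exact.
Qed.

Lemma cexp_tangent0_coord h : cexp h - 1 - h =
  (expR (complex.Re h) * cos (complex.Im h) - 1 - complex.Re h)
  +i* (expR (complex.Re h) * sin (complex.Im h) - complex.Im h).
Proof.
case: h => x y; rewrite cexpE.
by apply/eqP; rewrite eq_complex /= subr0 !eqxx.
Qed.

(** The two coordinates of [cexp h - 1 - h] are combinations, with bounded
coefficients, of the tangent remainders of [expR], [cos] and [sin] at 0 and of
the product of [expR - 1] with the second coordinate of [h]; each of these is
[o(h)]. With [2] as a bound for [expR], their weights are 2 and 1 in the first
coordinate and 2 and 1 in the second, which explains [d / 6]. *)
Lemma cexp_tangent0 (d : R) : 0 < d ->
  \forall h \near (0 : R[i]), cabs (cexp h - 1 - h) <= d * cabs h.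
Proof.
move=> d0; pose d' := Num.min 1 (d / 6).
have d'0 : 0 < d' by rewrite /d' lt_min ltr01 divr_gt0 // ltr0n.
have [d'1 d'6] : d' <= 1 /\ d' <= d / 6 by split; rewrite ge_min lexx ?orbT.
have /is_derive1P/(_ d' d'0) E := is_derive_expR (0 : R).
have /is_derive1P/(_ d' d'0) C := is_derive_cos (0 : R).
have /is_derive1P/(_ d' d'0) S := is_derive_sin (0 : R).
have /cvgrPdist_le/(_ d' d'0) E' := @continuous_expR R 0.
near=> h.
have := normIm_le h; have := normRe_le h.
have : `|sin (complex.Im h + 0) - sin 0 - cos 0 * complex.Im h| <= d' * `|complex.Im h|.
  by near: h; exact: near0_Im S.
have : `|cos (complex.Im h + 0) - cos 0 - - sin 0 * complex.Im h| <= d' * `|complex.Im h|.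
  by near: h; exact: near0_Im C.
have : `|expR (complex.Re h + 0) - expR 0 - expR 0 * complex.Re h| <= d' * `|complex.Re h|.
  by near: h; exact: near0_Re E.
have : `|expR 0 - expR (complex.Re h)| <= d'.
  by near: h; exact: near0_Re E'.
set x := complex.Re h; set y := complex.Im h.
rewrite !addr0 sin0 cos0 expR0 !mul1r oppr0 mul0r !subr0 !addr0.
move=> He' He Hc Hs Hx Hy.
rewrite (le_trans (cabs_le _)) // cexp_tangent0_coord /= -/x -/y.
have ex2 : `|expR x| <= 2.
  by rewrite ger0_norm ?expR_ge0 //; move: He'; rewrite ler_norml; lra.
have -> : expR x * cos y - 1 - x = expR x * (cos y - 1) + (expR x - 1 - x) by ring.
have -> : expR x * sin y - y = expR x * (sin y - y) + (expR x - 1) * y by ring.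
rewrite distrC in He'.
have A1 : `|expR x * (cos y - 1)| <= 2 * (d' * `|y|) by rewrite normrM ler_pM.
have A2 : `|expR x * (sin y - y)| <= 2 * (d' * `|y|) by rewrite normrM ler_pM.
have A3 : `|(expR x - 1) * y| <= d' * `|y| by rewrite normrM ler_wpM2r.
have A4 := ler_normD (expR x * (cos y - 1)) (expR x - 1 - x).
have A5 := ler_normD (expR x * (sin y - y)) ((expR x - 1) * y).
set c := cabs _ in Hx Hy *.
have c0 : 0 <= c by exact: cabs_ge0.
have : d' * c <= d / 6 * c by rewrite ler_wpM2r.
have : d' * `|x| <= d' * c by rewrite ler_wpM2l // ltW.
have : d' * `|y| <= d' * c by rewrite ler_wpM2l // ltW.
lra.
Unshelve. all: by end_near. Qed.

Lemma is_derive_cexp z : is_derive z 1 (@cexp R) (cexp z).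
Proof.
apply/is_deriveP => d d0.
have c0 : 0 < cabs (cexp z) by rewrite cabs_gt0 cexp_neq0.
apply: filterS (cexp_tangent0 (divr_gt0 d0 c0)) => h Hh.
rewrite cexpD.
have -> : cexp h * cexp z - cexp z - cexp z * h = cexp z * (cexp h - 1 - h) by ring.
rewrite cabsM -ler_pdivlMl // (le_trans Hh) // mulrA.
by rewrite [_^-1 * d]mulrC.
Qed.

Lemma is_derive_scale (c z : R[i]) : is_derive z 1 (fun w => c * w) c.
Proof.
apply/is_deriveP => d d0; near=> h.
by rewrite mulrDr addrK subrr cabs0 mulr_ge0 ?cabs_ge0 ?ltW.
Unshelve. all: by end_near. Qed.

Lemma is_derive_e z : is_derive z 1 (@e R) (2 * pi%:C * 'i * e z).
Proof.
rewrite mulrC; apply: is_derive_chain (is_derive_cexp _) (is_derive_scale _ _).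
Qed.

Lemma two_pi_i_neq0 : 2 * pi%:C * 'i != 0 :> R[i].
Proof.
rewrite !mulf_neq0 ?pnatr_eq0 //.
  by rewrite -cabs_eq0 cabs_real normr_eq0 gt_eqF // pi_gt0.
by rewrite eq_complex /= oner_eq0 andbF.
Qed.

Lemma e_pow n z : e (n%:R * z) = e z ^+ n :> R[i].
Proof. by rewrite /e -cexpMn; congr cexp; ring. Qed.

Lemma Re_2piiM z : complex.Re (2 * pi%:C * 'i * z) = - (2 * pi * complex.Im z) :> R.
Proof.
have -> : 2 * pi%:C * 'i = 0 +i* (2 * pi) :> R[i].
  by apply/eqP; rewrite eq_complex /=; apply/andP; split; apply/eqP; ring.
by case: z => x y /=; ring.
Qed.

Lemma cabs_e z : cabs (e z) = expR (- (2 * pi * complex.Im z)).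
Proof. by rewrite /e cabs_cexp Re_2piiM. Qed.

Lemma cabs_e_lt1 z : upper_half_plane z -> cabs (e z) < 1.
Proof.
move=> z0; rewrite cabs_e expR_lt1 oppr_lt0.
by rewrite !mulr_gt0 // pi_gt0.
Qed.

End ComplexExponential.

(** * Power series on the unit disc *)

Section PowerSeries.
Variable R : realType.
Implicit Types (u a : nat -> R[i]) (q h z : R[i]).

Lemma cvg_series_cabs u (M : nat -> R) (l : R[i]) (s : R) :
  (forall n, cabs (u n) <= M n) -> series u @ \oo --> l -> series M @ \oo --> s ->
  cabs l <= s.
Proof.
move=> uM ul Ms.
apply: (ler_cvg_to (cvg_cabs ul) Ms).
near=> n; rewrite /series /=.
apply: (big_ind2 (fun x y => cabs x <= y)).
- by rewrite cabs0.
- by move=> x1 x2 y1 y2 H1 H2; rewrite (le_trans (cabsD _ _)) // lerD.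
- by move=> i _; exact: uM.
Unshelve. all: by end_near. Qed.

(** Completeness of R is used coordinatewise: the real and imaginary parts are
absolutely convergent. *)
Lemma dominated_series u (M : nat -> R) :
  (forall n, cabs (u n) <= M n) -> cvgn (series M) ->
  exists l : R[i], series u @ \oo --> l.
Proof.
move=> uM Mc.
have M0 n : 0 <= M n by rewrite (le_trans _ (uM n)) // cabs_ge0.
have cv (v : nat -> R) : (forall n, `|v n| <= M n) -> cvgn (series v).
  move=> vM; apply: normed_cvg; apply: series_le_cvg Mc => n;
    rewrite ?normr_ge0 ?vM ?M0 //.
have /cv cR n : `|complex.Re (u n)| <= M n by rewrite (le_trans (normRe_le _)).
have /cv cI n : `|complex.Im (u n)| <= M n by rewrite (le_trans (normIm_le _)).
exists (limn (series (fun n => complex.Re (u n))) +i*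
        limn (series (fun n => complex.Im (u n)))).
have sR n : complex.Re (series u n) = series (fun n => complex.Re (u n)) n.
  by rewrite /series /= raddf_sum.
have sI n : complex.Im (series u n) = series (fun n => complex.Im (u n)) n.
  by rewrite /series /= raddf_sum.
apply: cvg_complex => /=.
- by under eq_fun do rewrite sR.
- by under eq_fun do rewrite sI.
Qed.

(** The form in which the radius of convergence is at least 1: it is what the
convergence of a Fourier series on the upper half plane provides, and by
comparison with a geometric series it gives absolute convergence on the disc. *)
Definition bounded_on_radii a :=
  forall r : R, 0 < r < 1 -> exists M : R, forall n, cabs (a n) * r ^+ n <= M.

(** Comparison with a geometric series of ratio [x / r], where [x < r < 1]. *)
Lemma cvg_power_norm a (x : R) : bounded_on_radii a -> 0 <= x < 1 ->
  cvgn (series (fun n => cabs (a n) * x ^+ n)).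
Proof.
move=> ha /andP[x0 x1].
pose r := (x + 1) / 2.
have [r0 r1 xr] : [/\ 0 < r, r < 1 & x < r] by rewrite /r; split; lra.
have [|M HM] := ha r; first by rewrite r0.
have xr0 : 0 <= x / r by rewrite divr_ge0 // ltW.
have : cvgn (series (geometric M (x / r))).
  apply: is_cvg_geometric_series.
  by rewrite ger0_norm // ltr_pdivrMr // mul1r.
apply: series_le_cvg => n.
- by rewrite mulr_ge0 ?cabs_ge0 ?exprn_ge0.
- rewrite /geometric /= mulr_ge0 ?exprn_ge0 //.
  by rewrite (le_trans _ (HM 0)) // mulr_ge0 ?cabs_ge0 ?exprn_ge0 // ltW.
rewrite /geometric /= expr_div_n.
have rn : 0 < r ^+ n by rewrite exprn_gt0.
rewrite (mulrCA M) mulrC ler_wpM2l ?exprn_ge0 //.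
by rewrite ler_pdivlMr // HM.
Qed.

Lemma cvg_power_series a q : bounded_on_radii a -> cabs q < 1 ->
  exists l : R[i], series (fun n => a n * q ^+ n) @ \oo --> l.
Proof.
move=> ha q1.
have H : 0 <= cabs q < 1 by rewrite cabs_ge0.
apply: dominated_series (cvg_power_norm ha H) => n.
by rewrite cabsM cabsX.
Qed.

Lemma exprD_tangent (K : comNzRingType) (x y : K) n :
  (x + y) ^+ n.+1 = x ^+ n.+1 + n.+1%:R * x ^+ n * y +
    \sum_(i < n) (x ^+ (n.+1 - i.+2) * y ^+ i.+2) *+ 'C(n.+1, i.+2).
Proof.
rewrite exprDn !big_ord_recl /= (_ : bump 0 0 = 1%N) // subn0 subn1 bin0 bin1 /=.
by rewrite expr0 expr1 mulr1 mulr1n -mulr_natl mulrA addrA.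
Qed.

(** After the two leading terms, the binomial expansion has only powers of [h] of
exponent at least 2. Since [cabs h <= d], replacing [h] by [d] in them loses at
most the factor [(cabs h / d) ^+ 2], and what remains is part of the expansion
of [(cabs q + d) ^+ n.+1]. This bound is free of polynomial factors in [n], so
it can be summed against the coefficients directly. *)
Lemma expr_tangent_le q h (d : R) n : 0 < d -> cabs h <= d ->
  cabs ((h + q) ^+ n.+1 - q ^+ n.+1 - n.+1%:R * q ^+ n * h)
    <= (cabs h / d) ^+ 2 * (cabs q + d) ^+ n.+1.
Proof.
move=> d0 hd.
have h0 := cabs_ge0 h; have q0 := cabs_ge0 q.
have hd0 : 0 <= cabs h / d by rewrite divr_ge0 // ltW.
rewrite [h + q]addrC !exprD_tangent.
set S := \sum_(i < n) _; set T := \sum_(i < n) _.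
have -> : q ^+ n.+1 + n.+1%:R * q ^+ n * h + S - q ^+ n.+1 - n.+1%:R * q ^+ n * h
   = S by ring.
apply: (@le_trans _ _ ((cabs h / d) ^+ 2 * T)); last first.
  rewrite ler_wpM2l ?exprn_ge0 // lerDr addr_ge0 ?exprn_ge0 //.
  by rewrite !mulr_ge0 ?exprn_ge0 // ltW.
rewrite /S /T mulr_sumr (le_trans (cabs_sum _)) //.
apply: ler_sum => i _.
rewrite cabsMn mulrnAr lerMn2r; apply/orP; right.
rewrite cabsM !cabsX [leRHS]mulrCA ler_wpM2l ?exprn_ge0 //.
have -> : cabs h ^+ i.+2 = (cabs h / d) ^+ i.+2 * d ^+ i.+2.
  by rewrite -exprMn divfK // gt_eqF.
rewrite ler_wpM2r ?exprn_ge0 ?(ltW d0) // ler_wiXn2l //.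
by rewrite ler_pdivrMr // mul1r.
Qed.

(** Termwise integration. Summing [expr_tangent_le] against the coefficients
turns absolute convergence at the radius [cabs q + d < 1] into a quadratic bound
for the remainder of [Q] at [q]. The derivative is described as a limit [l] of
the series, so that a known sum can be substituted for it. *)
Lemma power_series_primitive a : bounded_on_radii a ->
  exists2 Q : R[i] -> R[i], Q 0 = 0 &
    forall q (l : R[i]), cabs q < 1 -> series (fun n => a n * q ^+ n) @ \oo --> l ->
      is_derive q 1 Q l.
Proof.
move=> ha.
have coef_le n : cabs (a n / n.+1%:R) <= cabs (a n).
  rewrite cabsM cabsV cabs_nat ler_piMr ?cabs_ge0 // invf_le1 ?ltr0n //.
  by rewrite ler1n.
have cvQ q : cabs q < 1 ->
    exists l : R[i], series (fun n => a n / n.+1%:R * q ^+ n.+1) @ \oo --> l.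
  move=> q1; have q01 : 0 <= cabs q < 1 by rewrite cabs_ge0.
  apply: dominated_series (cvg_power_norm ha q01) => n.
  have an := coef_le n; have q0 := cabs_ge0 q.
  rewrite cabsM cabsX ler_pM ?cabs_ge0 ?exprn_ge0 //.
  by rewrite exprS ler_piMl ?exprn_ge0 // ltW.
pose Q q := xget 0 [set l : R[i] | series (fun n => a n / n.+1%:R * q ^+ n.+1) @ \oo --> l].
have QP q : cabs q < 1 -> series (fun n => a n / n.+1%:R * q ^+ n.+1) @ \oo --> Q q.
  by move=> /cvQ; exact: xgetPex.
exists Q.
  apply: cvgC_unique (QP 0 _) _; first by rewrite cabs0.
  have -> : series (fun n => a n / n.+1%:R * (0 : R[i]) ^+ n.+1) = fun=> 0.
    by apply/funext => n; rewrite /series /= big1 // => i _; rewrite expr0n mulr0.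
  exact: cvg_cst.
move=> q l q1 Hl.
(* half the distance to the unit circle, so that [cabs q + d] stays below 1 *)
pose d := (1 - cabs q) / 2.
have d0 : 0 < d by rewrite /d; lra.
have qd : 0 <= cabs q + d < 1.
  by rewrite /d; have := cabs_ge0 q; lra.
have /cvg_ex[/= K HK] := cvg_power_norm ha qd.
have bound h : cabs h <= d ->
    cabs (Q (h + q) - Q q - l * h) <= cabs h ^+ 2 * (K / d ^+ 2).
  move=> hd.
  have hq1 : cabs (h + q) < 1
    by apply: le_lt_trans (cabsD _ _) _; move: hd; rewrite /d; lra.
  pose u n := a n / n.+1%:R * ((h + q) ^+ n.+1 - q ^+ n.+1 - n.+1%:R * q ^+ n * h).
  have uS : series u @ \oo --> Q (h + q) - Q q - l * h.
    have -> : series u = (fun N => series (fun n => a n / n.+1%:R * (h + q) ^+ n.+1) N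
        - series (fun n => a n / n.+1%:R * q ^+ n.+1) N
        - series (fun n => a n * q ^+ n) N * h).
      apply/funext => N; rewrite /series /= mulr_suml -!sumrB.
      by apply: eq_bigr => n _; rewrite /u; field; rewrite nat1r pnatr_eq0.
    apply: cvgB; first exact: cvgB (QP _ hq1) (QP _ q1).
    exact: cvgM Hl (cvg_cst _).
  pose M n := (cabs h / d) ^+ 2 * (cabs (a n) * (cabs q + d) ^+ n).
  have MS : series M @ \oo --> (cabs h / d) ^+ 2 * K.
    have -> : series M = fun N => (cabs h / d) ^+ 2 *
        series (fun n => cabs (a n) * (cabs q + d) ^+ n) N.
      by apply/funext => N; rewrite /series /= mulr_sumr.
    exact: cvgM (cvg_cst _) HK.
  have -> : cabs h ^+ 2 * (K / d ^+ 2) = (cabs h / d) ^+ 2 * K.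
    by rewrite (expr_div_n (cabs h)) [K / _]mulrC mulrA.
  apply: cvg_series_cabs uS MS => n.
  rewrite /u /M cabsM mulrCA ler_pM ?cabs_ge0 //.
  rewrite (le_trans (expr_tangent_le _ _ d0 hd)) // ler_wpM2l ?sqr_ge0 //.
  by case/andP: qd => qd0 qd1; rewrite exprS ler_piMl ?exprn_ge0 // ltW.
apply/is_deriveP => r r0.
set C := K / d ^+ 2 in bound.
have C0 : 0 < `|C| + 1 by rewrite ltr_wpDl.
near=> h.
have hd : cabs h < d by near: h; exact: near0_cabs.
have hr : cabs h < r / (`|C| + 1) by near: h; apply: near0_cabs; rewrite divr_gt0.
rewrite (le_trans (bound h (ltW hd))) // expr2 -mulrA mulrC ler_wpM2r ?cabs_ge0 //.
have := ler_norm C.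
have h0 := cabs_ge0 h.
move: hr; rewrite ltr_pdivlMr // => hr CC.
have : cabs h * C <= cabs h * (`|C| + 1) by rewrite ler_wpM2l //; lra.
lra.
Unshelve. all: by end_near. Qed.

End PowerSeries.

(** * Primitives of Fourier series *)

Section Fourier.
Variable R : realType.
Implicit Types (z w : R[i]).
Local Notation HH := (@upper_half_plane R).

(** Evaluate at [0 +i* y] with [cabs (e (0 +i* y)) = r]: the terms of a convergent
series are bounded. *)
Lemma fourier_coefs (c : nat -> R[i]) (g : R[i] -> R[i]) :
  (forall z, HH z -> series (fun n => c n.+1 * e (n.+1%:R * z)) @ \oo --> g z) ->
  bounded_on_radii (fun n => c n.+1).
Proof.
move=> cg r /andP[r0 r1].
pose y := - ln r / (2 * pi).
have pi0 := pi_gt0 R.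
have y0 : 0 < y by rewrite divr_gt0 ?mulr_gt0 // oppr_gt0 ln_lt0 // r0.
have er : cabs (e (0 +i* y)) = r.
  rewrite cabs_e /= /y mulrCA divff ?mulr1 ?opprK ?lnK //.
  by rewrite mulf_neq0 // gt_eqF.
have /cvgP/cvg_series_cvg_0/cvg_cabs/cvgP/cvg_seq_bounded := cg (0 +i* y) y0.
move=> /pinfty_ex_gt0[B B0 HB].
exists (B / r) => n.
rewrite ler_pdivlMr // -mulrA -exprSr.
have := HB n I; rewrite /= ger0_norm ?cabs_ge0 //.
by rewrite cabsM e_pow cabsX er.
Qed.

(** In the coordinate [q = e z] the series is [q] times a power series, and
[dq = 2 pi i q dz]; hence the factor [q] is absorbed, and a primitive in [q] of
the power series is a primitive in [z] up to [2 pi i]. It vanishes at [q = 0],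
which is the limit at the cusp. *)
Lemma fourier_primitive (c : nat -> R[i]) (g : R[i] -> R[i]) :
  (forall z, HH z -> series (fun n => c n.+1 * e (n.+1%:R * z)) @ \oo --> g z) ->
  exists2 P : R[i] -> R[i], forall z, HH z -> is_derive z 1 P (g z) &
    P (0 +i* y) @[y --> +oo] --> (0 : R[i]).
Proof.
move=> cg; have ha := fourier_coefs cg.
have [Q Q0 Qd] := power_series_primitive ha.
exists (fun z => (2 * pi%:C * 'i)^-1 * Q (e z)).
  move=> z z0; have z1 := cabs_e_lt1 z0.
  have [l Hl] := cvg_power_series ha z1.
  have -> : g z = (2 * pi%:C * 'i)^-1 * (l * (2 * pi%:C * 'i * e z)).
    rewrite (mulrCA l) mulKf ?two_pi_i_neq0 //.
    apply: cvgC_unique (cg z z0) _.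
    have -> : series (fun n => c n.+1 * e (n.+1%:R * z)) =
        fun N => series (fun n => c n.+1 * e z ^+ n) N * e z.
      apply/funext => N; rewrite /series /= mulr_suml.
      by apply: eq_bigr => n _; rewrite e_pow exprSr mulrA.
    exact: cvgM Hl (cvg_cst _).
  apply: (is_derive_chain (is_derive_scale _ _)).
  exact: is_derive_chain (Qd _ _ z1 Hl) (is_derive_e z).
rewrite -(mulr0 (2 * pi%:C * 'i)^-1) -Q0.
apply: cvgM; first exact: cvg_cst.
have [l Hl] : exists l : R[i], series (fun n => c n.+1 * 0 ^+ n) @ \oo --> l.
  by apply: cvg_power_series ha _; rewrite cabs0.
have Qc : {for 0, continuous Q}.
  by apply: is_derive_continuous (Qd _ _ _ Hl); rewrite cabs0.
suff e0 : e (0 +i* y) @[y --> +oo] --> (0 : R[i]) by exact: cvg_comp e0 Qc.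
apply: cvg0_cabs => d d0.
have pi0 := pi_gt0 R.
have /cvgrPdist_lt/(_ d d0) [/= A [Ar HA]] := @cvgr_expR R.
have ce y : expR (- (2 * pi * y)) < d -> cabs (e (0 +i* y)) < d by rewrite cabs_e.
suff : \forall y \near +oo, expR (- (2 * pi * y)) < d.
  exact: filterS ce.
near=> y.
have := HA (2 * pi * y); rewrite sub0r normrN ger0_norm ?expR_ge0 //; apply.
rewrite mulrC -ltr_pdivrMr ?mulr_gt0 //.
by near: y; apply: nbhs_pinfty_gt; rewrite num_real.
Unshelve. all: by end_near. Qed.

End Fourier.

(** * Integrals along segments *)

Section LineIntegrals.
Variable R : realType.
Implicit Types (z w : R[i]) (P g : R[i] -> R[i]).
Local Notation HH := (@upper_half_plane R).
Local Notation mu := (@lebesgue_measure R).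

Lemma cvg_segment (d z : R[i]) (t : R) :
  z + s%:C * d @[s --> t] --> z + t%:C * d.
Proof.
apply: cvgD; first exact: cvg_cst.
by apply: cvgM; [apply: cvg_real; exact: cvg_id|exact: cvg_cst].
Qed.

(** The real part of a multiple by [k] covers real parts ([k = 1]) and imaginary
parts ([k = - 'i]) at once. *)
Lemma is_derive_segment P (z d k l : R[i]) (t : R) :
  is_derive (z + t%:C * d) 1 P l ->
  is_derive t 1 (fun s : R => complex.Re (P (z + s%:C * d) * k))
    (complex.Re (l * d * k)).
Proof.
move=> /is_deriveP HP; apply/is_derive1P => r r0.
have c0 : 0 < cabs d * cabs k + 1 by rewrite ltr_wpDl // mulr_ge0 ?cabs_ge0.
have := HP _ (divr_gt0 r0 c0).
have : s%:C * d @[s --> (0 : R)] --> (0 : R[i]).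
  by have := @cvg_segment d 0 0; rewrite mul0r add0r; under eq_fun do rewrite add0r.
move=> /[apply] H.
near=> s.
have Hs : cabs (P (s%:C * d + (z + t%:C * d)) - P (z + t%:C * d) - l * (s%:C * d))
    <= r / (cabs d * cabs k + 1) * cabs (s%:C * d) by near: s; exact: H.
have -> : z + (s + t)%:C * d = s%:C * d + (z + t%:C * d).
  by rewrite rmorphD mulrDl; ring.
have -> : complex.Re (l * d * k) * s = complex.Re (l * (s%:C * d) * k).
  have -> : l * (s%:C * d) * k = s%:C * (l * d * k) by ring.
  by rewrite Re_realM mulrC.
rewrite -!raddfB -!mulrBl (le_trans (normRe_le _)) // cabsM.
rewrite (le_trans (ler_wpM2r (cabs_ge0 k) Hs)) // cabsM cabs_real.
have -> : r / (cabs d * cabs k + 1) * (`|s| * cabs d) * cabs k =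
  (cabs d * cabs k / (cabs d * cabs k + 1)) * (r * `|s|) by ring.
rewrite ler_piMl ?mulr_ge0 // ?(ltW r0) //.
by rewrite ler_pdivrMr // mul1r lerDl.
Unshelve. all: by end_near. Qed.

Lemma integral_segment P g (z d k : R[i]) :
  (forall t : R, 0 <= t <= 1 -> HH (z + t%:C * d)) ->
  (forall u, HH u -> is_derive u 1 P (g u)) ->
  (forall u, HH u -> {for u, continuous g}) ->
  \int[mu]_(t in `[0, 1]) complex.Re (g (z + t%:C * d) * d * k) =
    complex.Re (P (z + d) * k) - complex.Re (P z * k).
Proof.
move=> Hz HP Hg.
have gc (t : R) : 0 <= t <= 1 ->
    {for t, continuous (fun s : R => complex.Re (g (z + s%:C * d) * d * k))}.
  move=> t01; apply: cvg_Re.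
  apply: cvgM; last exact: cvg_cst.
  apply: cvgM; last exact: cvg_cst.
  exact: cvg_comp (@cvg_segment d z t) (Hg _ (Hz t t01)).
pose p (s : R) := complex.Re (P (z + s%:C * d) * k).
have dp (t : R) : 0 <= t <= 1 -> is_derive t 1 p (complex.Re (g (z + t%:C * d) * d * k)).
  by move=> t01; apply: is_derive_segment; apply: HP; exact: Hz.
have pc (t : R) : 0 <= t <= 1 -> {for t, continuous p}.
  move=> /dp[dpt _]; apply: differentiable_continuous; exact/derivable1_diffP.
have -> : complex.Re (P (z + d) * k) - complex.Re (P z * k) = p 1 - p 0.
  by rewrite /p mul1r mul0r addr0.
rewrite /Rintegral (@continuous_FTC2 _ _ p) //.
- apply/continuous_in_subspaceT => t; rewrite inE /= in_itv /=; exact: gc.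
- split.
  + move=> t; rewrite in_itv /= => /andP[t0 t1].
    have t01 : 0 <= t <= 1 by rewrite !ltW.
    by have [] := dp t t01.
  + by apply: cvg_at_right_filter; apply: pc; rewrite lexx ler01.
  + by apply: cvg_at_left_filter; apply: pc; rewrite lexx ler01.
- move=> t; rewrite in_itv /= => /andP[t0 t1].
  have t01 : 0 <= t <= 1 by rewrite !ltW.
  have [dpt <-] := dp t t01.
  by rewrite derive1E.
Qed.

Lemma upper_half_plane_convex z w (t : R) : HH z -> HH w -> 0 <= t <= 1 -> HH (z + t%:C * (w - z)).
Proof.
case: z w => [x y] [x' y']; rewrite /upper_half_plane /= => y0 y'0 /andP[t0 t1].
have [->|tn0] := eqVneq t 0; first lra.
have : 0 < t * y' by rewrite mulr_gt0 // lt_def tn0.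
have : 0 <= (1 - t) * y by apply: mulr_ge0; [rewrite subr_ge0|exact: ltW].
lra.
Qed.

(** [line_integral] integrates the two coordinates of [g] along the segment, with
the direction [w - z] outside the integral; [integral_segment] is therefore used
for the primitive [P] divided by that direction. *)
Lemma line_integral_primitive P g z w : HH z -> HH w ->
  (forall u, HH u -> is_derive u 1 P (g u)) ->
  (forall u, HH u -> {for u, continuous g}) ->
  line_integral g z w = P w - P z.
Proof.
move=> Hz Hw HP Hg; rewrite /line_integral.
have [->|wz] := eqVneq w z; first by rewrite !subrr mul0r.
set d := w - z.
have d0 : d != 0 by rewrite subr_eq0.
have Hseg (t : R) : 0 <= t <= 1 -> HH (z + t%:C * d) by exact: upper_half_plane_convex.
have zd : z + d = w by rewrite /d; ring.
have HR := integral_segment d^-1 Hseg HP Hg.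
have HI := integral_segment (- 'i / d) Hseg HP Hg.
have <- : d * ((P w - P z) / d) = P w - P z by rewrite mulrC divfK.
congr (_ * _); apply/eqP; rewrite eq_complex /=; apply/andP; split; apply/eqP.
  rewrite -[RHS]/(complex.Re _) mulrBl raddfB /= -zd -HR.
  by apply: eq_Rintegral => t _; rewrite mulfK.
rewrite -[RHS]/(complex.Im _) ImRe mulrBl mulrBl raddfB /= -!mulrA ![d^-1 * _]mulrC -zd -HI.
by apply: eq_Rintegral => t _; rewrite ImRe -mulrA [d * _]mulrC divfK.
Qed.

Lemma const_of_derive0 P z w : HH z -> HH w ->
  (forall u, HH u -> is_derive u 1 P 0) -> P z = P w.
Proof.
move=> Hz Hw HP.
have PG u : HH u -> is_derive u 1 P (cst 0 u) by exact: HP.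
have HL : line_integral (cst 0) z w = P w - P z.
  apply: line_integral_primitive Hz Hw PG _ => u _; exact: cst_continuous.
have L0 : line_integral (cst 0) z w = 0 :> R[i].
  by rewrite /line_integral /Rintegral !integral0 /= [0 +i* 0]/(0 : R[i]) mulr0.
by apply/esym/eqP; rewrite -subr_eq0 -HL L0.
Qed.

End LineIntegrals.

(** * Moebius transformations *)

Section Moebius.
Variable R : realType.
Implicit Types (z w : R[i]) (g M N : 'M[R]_2).
Local Notation HH := (@upper_half_plane R).

Lemma det_mx2 g : \det g = g 0 0 * g 1 1 - g 0 1 * g 1 0.
Proof.
rewrite (expand_det_row _ 0) !big_ord_recl big_ord0 /cofactor !det_mx11 !mxE /=.
have -> : lift 0 (0 : 'I_1) = 1 :> 'I_2 by exact: val_inj.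
have -> : lift 1 (0 : 'I_1) = 0 :> 'I_2 by exact: val_inj.
by rewrite expr0 expr1 mul1r addr0 mulN1r mulrN.
Qed.

Lemma mulmx2E M N i j : (M *m N) i j = M i 0 * N 0 j + M i 1 * N 1 j.
Proof.
rewrite mxE !big_ord_recl big_ord0 addr0.
by have -> : lift 0 (0 : 'I_1) = 1 :> 'I_2 by exact: val_inj.
Qed.

Lemma upper_half_plane_i : HH 'i.
Proof. exact: ltr01. Qed.

Lemma jfactor_neq0 g z : \det g = 1 -> HH z -> jfactor g z != 0.
Proof.
rewrite det_mx2 /upper_half_plane /jfactor => gdet; case: z => x y /= y0.
rewrite eq_complex /= mul0r subr0 mul0r !addr0; apply/negP => /andP[/eqP H1 /eqP H2].
have c0 : g 1 0 = 0.
  by move/eqP: H2; rewrite mulf_eq0 (gt_eqF y0) orbF => /eqP.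
move: H1 gdet; rewrite c0 mul0r add0r => ->.
by rewrite !mulr0 subrr => /esym/eqP; rewrite oner_eq0.
Qed.

(** Multiplying numerator and denominator by the conjugate of the denominator
leaves [\det g = 1] in front of the imaginary part. *)
Lemma Im_moebius g z : \det g = 1 -> HH z ->
  complex.Im (moebius g z) = complex.Im z / cabs (jfactor g z) ^+ 2.
Proof.
move=> gdet z0; have j0 := jfactor_neq0 gdet z0.
have c0 : cabs (jfactor g z) ^+ 2 != 0 by rewrite sqrf_eq0 cabs_eq0.
set n := (g 0 0)%:C * z + (g 0 1)%:C.
have E : (cabs (jfactor g z) ^+ 2)%:C * moebius g z = n * (jfactor g z)^*.
  by rewrite cabs_sqr /moebius -/n mulrAC mulrCA mulfV ?mulr1.
apply: (mulfI c0).
rewrite [RHS]mulrC divfK //.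
transitivity (complex.Im ((cabs (jfactor g z) ^+ 2)%:C * moebius g z)).
  by case: (moebius g z) => a b /=; ring.
rewrite E /n /jfactor; move: gdet; rewrite det_mx2; case: z {z0 j0 c0 n E} => x y /= gdet.
rewrite -[RHS]mul1r -gdet; ring.
Qed.

Lemma moebius_upper_half_plane g z : \det g = 1 -> HH z -> HH (moebius g z).
Proof.
move=> gdet z0; rewrite /upper_half_plane /= Im_moebius // divr_gt0 //.
by rewrite exprn_gt0 // cabs_gt0 jfactor_neq0.
Qed.

Lemma jfactorM M N z : \det N = 1 -> HH z ->
  jfactor (M *m N) z = jfactor M (moebius N z) * jfactor N z.
Proof.
move=> /jfactor_neq0 H /H j0.
have E : moebius N z * jfactor N z = (N 0 0)%:C * z + (N 0 1)%:C by rewrite divfK.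
rewrite [jfactor M _]/jfactor mulrDl -mulrA E.
by rewrite /jfactor !mulmx2E !rmorphD !rmorphM /=; ring.
Qed.

Lemma moebiusM M N z : \det M = 1 -> \det N = 1 -> HH z ->
  moebius (M *m N) z = moebius M (moebius N z).
Proof.
move=> Mdet Ndet z0.
have jN := jfactor_neq0 Ndet z0.
have jM := jfactor_neq0 Mdet (moebius_upper_half_plane Ndet z0).
rewrite [LHS]/moebius jfactorM // [RHS]/moebius.
rewrite invfM mulrA mulrAC; congr (_ / _).
have E : moebius N z * jfactor N z = (N 0 0)%:C * z + (N 0 1)%:C by rewrite divfK.
apply: (mulIf jN); rewrite divfK // mulrDl -mulrA E.
by rewrite /jfactor !mulmx2E !rmorphD !rmorphM /=; ring.
Qed.

Lemma moebius1 z : moebius 1%:M z = z.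
Proof. by rewrite /moebius /jfactor !mxE /= mul0r add0r divr1 addr0 mul1r. Qed.

Lemma jfactor1 z : jfactor 1%:M z = 1.
Proof. by rewrite /jfactor !mxE /= mul0r add0r. Qed.

Lemma moebius_sub g z w : \det g = 1 -> jfactor g z != 0 -> jfactor g w != 0 ->
  moebius g w - moebius g z = (w - z) / (jfactor g w * jfactor g z).
Proof.
move=> gdet jz jw.
have D : (g 0 0)%:C * (g 1 1)%:C - (g 0 1)%:C * (g 1 0)%:C = 1.
  by rewrite -!rmorphM -rmorphB -det_mx2 gdet.
apply: (mulIf (mulf_neq0 jw jz)); rewrite divfK ?mulf_neq0 // mulrBl.
rewrite {1}/moebius mulrA divfK // [jfactor g w * _]mulrC {1}/moebius mulrA divfK //.
by rewrite -[RHS]mul1r -D /jfactor; ring.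
Qed.

(** By [moebius_sub] the difference quotient is the inverse of a product of two
automorphy factors, which is continuous. *)
Lemma is_derive_moebius g z : \det g = 1 -> HH z ->
  is_derive z 1 (moebius g) (jfactor g z ^- 2).
Proof.
move=> gdet z0; have j0 := jfactor_neq0 gdet z0.
have Jc : jfactor g (h + z) @[h --> (0 : R[i])] --> jfactor g z.
  have hz : h + z @[h --> (0 : R[i])] --> z.
    apply/(@cvg_cabsP _ _ (nbhs (0 : R[i]))) => d d0; apply: filterS (near0_cabs d0) => h.
    by rewrite opprD addrCA subrr addr0 cabsN.
  exact: (cvgD (cvgM (cvg_cst (g 1 0)%:C) hz) (cvg_cst (g 1 1)%:C)).
have JVc : (jfactor g (h + z))^-1 * (jfactor g z)^-1 @[h --> (0 : R[i])]
    --> jfactor g z ^- 2.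
  rewrite expr2 invfM.
  exact: (cvgM (cvgV j0 Jc) (cvg_cst (jfactor g z)^-1)).
apply/is_deriveP => d d0.
have Jpos : 0 < cabs (jfactor g z) by rewrite cabs_gt0.
near=> h.
have jh : jfactor g (h + z) != 0.
  near: h; move/cvg_cabsP/(_ _ Jpos): Jc; apply: filterS => h.
  by apply: contraTneq => ->; rewrite subr0 ltxx.
have Hd : cabs (jfactor g z ^- 2 - (jfactor g (h + z))^-1 * (jfactor g z)^-1) < d.
  by near: h; move/cvg_cabsP: JVc; exact.
have -> : moebius g (h + z) - moebius g z - jfactor g z ^- 2 * h =
    - (jfactor g z ^- 2 - (jfactor g (h + z))^-1 * (jfactor g z)^-1) * h.
  by rewrite moebius_sub // addrK invfM expr2 invfM; ring.
by rewrite cabsM cabsN ler_wpM2r ?cabs_ge0 // ltW.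
Unshelve. all: by end_near. Qed.

End Moebius.

(** * The principal logarithm *)

Section ComplexLogarithm.
Variable R : realType.
Implicit Types (z w : R[i]).

Lemma cos_int_period (t : R) (k : int) : cos (t + (pi *+ 2) *~ k) = cos t.
Proof.
case: k => n; first exact: (periodicn (@cosD2pi R)).
rewrite NegzE mulrNz -(periodicn (@cosD2pi R) n.+1 (t - _)).
by rewrite pmulrn subrK.
Qed.

(** Reduce to a period; on [[0, pi]] the cosine is injective, and beyond [pi] the
angle is replaced by its complement to [2 pi]. *)
Lemma cos_eq1 (t : R) : cos t = 1 -> exists k : int, t = (pi *+ 2) *~ k.
Proof.
move=> ct; have pi0 := pi_gt0 R.
have p20 : 0 < pi *+ 2 :> R by rewrite mulrn_wgt0.
pose k := Num.floor (t / (pi *+ 2)); exists k.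
pose s := t - (pi *+ 2) *~ k.
have cs : cos s = 1 by rewrite -(cos_int_period s k) /s subrK.
have /andP[k1 k2] := floor_itv (t / (pi *+ 2)).
have s0 : 0 <= s by move: k1; rewrite ler_pdivlMr // mulrzl subr_ge0.
have s2 : s < pi *+ 2.
  by move: k2; rewrite ltr_pdivrMr // mulrzl mulrzDr mulr1z ltrBlDl.
suff : s = 0 by rewrite /s => /eqP; rewrite subr_eq0 => /eqP.
have [sp|sp] := leP s pi.
  by apply: cos_inj; rewrite ?in_itv /= ?lexx ?s0 ?sp ?ltW // cs cos0.
have : pi *+ 2 - s = 0.
  apply: cos_inj; rewrite ?in_itv /= ?lexx ?(ltW pi0) //.
    by apply/andP; split; lra.
  by rewrite addrC cosD2pi cosN cs cos0.
lra.
Qed.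

Lemma cexp_eq1 z : cexp z = 1 -> exists k : int, z = 2 * pi%:C * 'i * k%:~R.
Proof.
move=> ez; have : cabs (cexp z) = 1 by rewrite ez cabs1.
rewrite cabs_cexp => /(congr1 (@ln R)); rewrite expRK ln1 => x0.
move: ez; rewrite /cexp x0 expR0 mul1r => -[/cos_eq1[k kE] _].
exists k; case: z x0 kE => x y /= -> ->.
rewrite -(rmorph_int (real_complex R)).
by apply/eqP; rewrite eq_complex /= -mulrzl -(mulr_natl pi); apply/andP; split; apply/eqP; ring.
Qed.

Lemma cexp_clog z : z != 0 -> cexp (clog z) = z.
Proof.
move=> z0; have c0 : 0 < cabs z by rewrite cabs_gt0.
have sq : cabs z ^+ 2 = complex.Re z ^+ 2 + complex.Im z ^+ 2.
  by rewrite cabsE sqr_sqrtr // addr_ge0 ?sqr_ge0.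
set x := complex.Re z / cabs z.
have x1 : -1 <= x <= 1.
  by rewrite -ler_norml normrM normfV (gtr0_norm c0) ler_pdivrMr // mul1r normRe_le.
have cx : cos (acos x) = x by apply: acosK; rewrite in_itv.
have sx : sin (acos x) = `|complex.Im z| / cabs z.
  rewrite sin_acos //.
  have -> : 1 - x ^+ 2 = (complex.Im z / cabs z) ^+ 2.
    have c20 : cabs z ^+ 2 != 0 by rewrite gt_eqF // exprn_gt0.
    rewrite /x !expr_div_n -[1](divff c20) -mulrBl sq; congr (_ / _); ring.
  by rewrite sqrtr_sqr normrM normfV (gtr0_norm c0).
rewrite /clog cexpE lnK ?posrE // /carg -/x.
rewrite [RHS](_ : z = complex.Re z +i* complex.Im z); last by case: (z).
case: ifPn => Hi; rewrite ?cosN ?sinN cx sx /x.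
  by rewrite ger0_norm // ![cabs z * _]mulrC !divfK ?gt_eqF.
rewrite ltr0_norm ?ltNge // mulNr opprK ![cabs z * _]mulrC !divfK ?gt_eqF //.
Qed.

(** The exponential of the numerator is [v * w / u = 1]. *)
Lemma clogM_mod u v w : u != 0 -> v != 0 -> w != 0 -> u = v * w ->
  exists k : int, (- clog u + clog v + clog w) / (2 * pi%:C * 'i) = k%:~R.
Proof.
move=> u0 v0 w0 uvw.
have [|k ->] := @cexp_eq1 (- clog u + clog v + clog w).
  rewrite !cexpD (cexp_clog v0) (cexp_clog w0).
  have := cexpD (- clog u) (clog u).
  rewrite addNr cexp0 (cexp_clog u0) => {1}->.
  by rewrite -mulrA uvw.
exists k.
by rewrite mulrAC mulfV ?mul1r // two_pi_i_neq0.
Qed.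
End ComplexLogarithm.

(** * Periods of cusp forms *)

Section Periods.
Variable R : realType.
Implicit Types (z w : R[i]) (g M N : 'M[R]_2) (f P : R[i] -> R[i]).
Local Notation HH := (@upper_half_plane R).

Lemma primitive_unique f P1 P2 z w : HH z -> HH w ->
  (forall u, HH u -> is_derive u 1 P1 (f u)) ->
  (forall u, HH u -> is_derive u 1 P2 (f u)) ->
  P1 z - P2 z = P1 w - P2 w.
Proof.
move=> Hz Hw H1 H2; apply: (const_of_derive0 (P := P1 - P2) Hz Hw) => u Hu.
by rewrite -(subrr (f u)); apply: is_deriveB; [exact: H1|exact: H2].
Qed.

Lemma is_derive_slash f P g z : \det g = 1 -> HH z ->
  (forall u, HH u -> is_derive u 1 P (f u)) ->
  is_derive z 1 (P \o moebius g) (jfactor g z ^- 2 * f (moebius g z)).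
Proof.
move=> gdet Hz HP; rewrite mulrC.
by apply: is_derive_chain; [apply: HP; exact: moebius_upper_half_plane|exact: is_derive_moebius].
Qed.

(** Weight 2 makes [f dz] invariant, so that [P] and [P \o moebius g] are two
primitives of [f] and differ by a constant: the period of [f] along [g]. *)
Lemma automorphic_primitive f P g z w : \det g = 1 -> HH z -> HH w ->
  (forall u, HH u -> f (moebius g u) = jfactor g u ^+ 2 * f u) ->
  (forall u, HH u -> is_derive u 1 P (f u)) ->
  P (moebius g z) - P z = P (moebius g w) - P w.
Proof.
move=> gdet Hz Hw fg HP.
apply: (primitive_unique (P1 := P \o moebius g) Hz Hw _ HP) => u Hu.
have := is_derive_slash gdet Hu HP.
by rewrite fg // mulKf // expf_neq0 // jfactor_neq0.
Qed.

Section CuspForm.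
Variables (G : set 'M[R]_2) (f : R[i] -> R[i]) (a : option R) (sigma : 'M[R]_2).
Hypotheses (detG : forall g, G g -> \det g = 1)
  (cusp_form_f : cusp_form2 G f) (cusp_infty : is_cusp G None)
  (scaling_infty : scaling_matrix G None 1%:M)
  (cusp_a : is_cusp G a) (scaling_a : scaling_matrix G a sigma).

Lemma cusp_form_continuous z : HH z -> {for z, continuous f}.
Proof.
move=> /(cusp_form2_holomorphic cusp_form_f) df.
by apply: differentiable_continuous; apply/derivable1_diffP.
Qed.

(** The expansion at infinity, where the scaling matrix is the identity, converges
on the whole upper half plane, so that it gives a global primitive and replaces
Cauchy's theorem. *)
Lemma cusp_form_primitive :
  exists P, forall z, HH z -> is_derive z 1 P (f z).
Proof.
have [c Hc] := cusp_form2_fourier cusp_form_f cusp_infty scaling_infty.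
have [|P HP _] := @fourier_primitive R c f; last by exists P.
move=> z Hz; have := Hc z Hz.
by rewrite jfactor1 moebius1 expr1n invr1 mul1r.
Qed.

Lemma line_integral_period g z : G g -> HH z ->
  2 * pi%:C * 'i * line_integral f z (moebius g z) = modular_symbol f g.
Proof.
move=> Gg Hz; have [P HP] := cusp_form_primitive.
have gdet := detG Gg.
rewrite /modular_symbol !(line_integral_primitive _ _ HP cusp_form_continuous) //;
  try exact: upper_half_plane_i;
  try (apply: moebius_upper_half_plane => //; exact: upper_half_plane_i).
congr (_ * _); apply: automorphic_primitive gdet Hz (@upper_half_plane_i R) _ HP.
by move=> u Hu; exact: (cusp_form2_automorphic cusp_form_f Gg Hu).
Qed.

Lemma line_integral_chasles z w u : HH z -> HH w -> HH u ->
  line_integral f z u = line_integral f z w + line_integral f w u.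
Proof.
move=> Hz Hw Hu; have [P HP] := cusp_form_primitive.
rewrite !(line_integral_primitive _ _ HP cusp_form_continuous) //.
ring.
Qed.

Lemma modular_symbolM M N : G M -> G N ->
  modular_symbol f (M *m N) = modular_symbol f M + modular_symbol f N.
Proof.
move=> GM GN; have Ni := moebius_upper_half_plane (detG GN) (@upper_half_plane_i R).
have MNi := moebius_upper_half_plane (detG GM) Ni.
rewrite -(line_integral_period GM Ni) [LHS]/modular_symbol.
rewrite (moebiusM (detG GM) (detG GN) (@upper_half_plane_i R)).
by rewrite (line_integral_chasles (@upper_half_plane_i R) Ni MNi) mulrDr addrC.
Qed.

(** Near the cusp, [P \o moebius sigma] differs by a constant [k] from the
primitive given by the expansion at that cusp, which tends to 0; so the base
point of the integral can be moved to the cusp. *)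
Lemma line_integral_cusp_cvg : exists P, exists2 k : R[i],
  (forall z, HH z -> is_derive z 1 P (f z)) &
  forall z, HH z -> line_integral f (moebius sigma (0 +i* y)) z @[y --> +oo] --> P z - k.
Proof.
have [P HP] := cusp_form_primitive.
have [sdet _ _] := scaling_a.
have [c Hc] := cusp_form2_fourier cusp_form_f cusp_a scaling_a.
have [Pa HPa Pa0] := fourier_primitive Hc.
pose k := P (moebius sigma 'i) - Pa 'i.
exists P, k; first exact: HP.
move=> z Hz.
have Pk y : 0 < y -> P (moebius sigma (0 +i* y)) = Pa (0 +i* y) + k.
  move=> y0.
  have Hy : HH (0 +i* y) by [].
  have dPs u (Hu : HH u) := is_derive_slash sdet Hu HP.
  have := primitive_unique Hy (@upper_half_plane_i R) dPs HPa.
  by rewrite -/k /= => <-; ring.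
have L : P z - (Pa (0 +i* y) + k) @[y --> +oo] --> P z - k.
  rewrite -[k in X in _ --> X]add0r.
  apply: cvgB; first exact: cvg_cst.
  by apply: cvgD; [exact: Pa0|exact: cvg_cst].
apply: cvg_trans L; apply: near_eq_cvg.
near=> y.
have y0 : 0 < y by near: y; apply: nbhs_pinfty_gt; rewrite num_real.
rewrite (line_integral_primitive _ Hz HP cusp_form_continuous) ?Pk //.
exact: moebius_upper_half_plane.
Unshelve. all: by end_near. Qed.

Lemma cusp_integral_moebius g z : G g -> HH z ->
  cusp_integral f sigma (moebius g z) =
    cusp_integral f sigma z + modular_symbol f g.
Proof.
move=> Gg Hz; have [P [k HP Pk]] := line_integral_cusp_cvg.
have cE w : HH w -> cusp_integral f sigma w = 2 * pi%:C * 'i * (P w - k).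
  move=> /Pk L; rewrite /cusp_integral; congr (_ * _).
  by apply: cvg_lim L.
have Hgz := moebius_upper_half_plane (detG Gg) Hz.
rewrite !cE // -(line_integral_period Gg Hz).
rewrite (line_integral_primitive _ _ HP cusp_form_continuous) //.
ring.
Qed.
End CuspForm.
End Periods.

(** * Cocycles of the Dedekind symbols *)

Section Cocycles.
Variable R : realType.
Implicit Types (z w : R[i]) (M N : 'M[R]_2).

(** By the cocycle relation [jfactorM] the first logarithm is that of the product
of the arguments of the two others. *)
Lemma omega_int M N : \det M = 1 -> \det N = 1 ->
  exists k : int, omega M N = k%:~R.
Proof.
move=> Mdet Ndet; have Hi := upper_half_plane_i R.
have HNi := moebius_upper_half_plane Ndet Hi.
apply: clogM_mod; rewrite ?jfactor_neq0 ?det_mulmx ?Mdet ?Ndet ?mulr1 //.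
exact: jfactorM.
Qed.

Lemma real_int (x : R) (k : int) : x%:C = k%:~R -> x \is a Num.int.
Proof.
by rewrite -(rmorph_int (real_complex R)) => /complexI ->; rewrite intr_int.
Qed.

Lemma conjD z w : ((z + w)^* = z^* + w^*)%R.
Proof. exact: rmorphD. Qed.

Lemma subr_swap (x y p q : R[i]) : x - y = p - q -> q = p - (x - y).
Proof. by move=> ->; ring. Qed.

(** This is [V / (2 pi)] times the imaginary part of [m * n^*]: up to
the phase factor, the defect of additivity of the higher-order symbol in terms of
the periods [m] and [n]. *)
Definition period_pairing (V : R) (m n : R[i]) : R[i] :=
  V%:C * (m * n^* - n * m^*) / 2 / (2 * pi%:C * 'i).

Lemma period_pairingDl V m n p :
  period_pairing V (m + n) p = period_pairing V m p + period_pairing V n p.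
Proof. by rewrite /period_pairing conjD; ring. Qed.

Section Symbols.
Variables (G : set 'M[R]_2) (f : R[i] -> R[i]) (a : option R) (sigma : 'M[R]_2).
Hypotheses (fuchsian_G : fuchsian_first_kind G)
  (cusp_form_f : cusp_form2 G f) (cusp_infty : is_cusp G None)
  (scaling_infty : scaling_matrix G None 1%:M)
  (cusp_a : is_cusp G a) (scaling_a : scaling_matrix G a sigma).

(** Apply the functional equation at ['i] to the product, and at [moebius N 'i]
and ['i] to the factors: the values of [H] cancel. *)
Lemma dedekind_cocycle S M N : modular_dedekind_symbol G f a sigma S ->
  G M -> G N -> (S (M *m N) - S M - S N)%:C = omega M N.
Proof.
move=> [H _ HS] GM GN.
have Hi := upper_half_plane_i R.
have HNi := moebius_upper_half_plane (fuchsian_det fuchsian_G GN) Hi.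
have E12 := HS _ _ (fuchsian_mul fuchsian_G GM GN) Hi.
have E1 := HS _ _ GM HNi; have E2 := HS _ _ GN Hi.
rewrite moebiusM ?(fuchsian_det fuchsian_G) // in E12.
apply: (mulfI (two_pi_i_neq0 R)).
rewrite [omega _ _]/omega [RHS]mulrC divfK ?two_pi_i_neq0 // !rmorphB /=.
rewrite !mulrBr (subr_swap E12) (subr_swap E1) (subr_swap E2); ring.
Qed.

(** As for [dedekind_cocycle]. The values of the cusp integral [F] at
[moebius N 'i] and ['i] differ by the period [n] of [N]; with [m] the period of
[M], the terms in [F] cancel and, up to the factor [V_f G f],
[(|m + n|^2 - |m|^2 - |n|^2) / 2 - m^* * n] remains, that is, half of
[n^* * m - m^* * n]. *)
Lemma higher_dedekind_cocycle S M N : higher_dedekind_symbol G f a sigma S ->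
  G M -> G N -> (S (M *m N) - S M - S N)%:C =
   omega M N + period_pairing (V_f G f) (modular_symbol f M) (modular_symbol f N).
Proof.
move=> [H _ HS] GM GN.
have detG := fuchsian_det fuchsian_G.
have Hi := upper_half_plane_i R.
have HNi := moebius_upper_half_plane (detG _ GN) Hi.
have E12 := HS _ _ (fuchsian_mul fuchsian_G GM GN) Hi.
have E1 := HS _ _ GM HNi; have E2 := HS _ _ GN Hi.
rewrite (moebiusM (detG _ GM) (detG _ GN) Hi) in E12.
rewrite (modular_symbolM detG cusp_form_f cusp_infty scaling_infty GM GN) in E12.
rewrite (cusp_integral_moebius detG cusp_form_f cusp_infty
  scaling_infty cusp_a scaling_a GN Hi) in E1.
have half z : (cabs z ^+ 2 / 2)%:C = z * z^* / 2.
  rewrite rmorphM fmorphV rmorph_nat /= -cabs_sqr //.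
rewrite !half ?conjD in E12 E1 E2.
apply: (mulfI (two_pi_i_neq0 R)).
rewrite mulrDr [omega _ _]/omega /period_pairing.
rewrite ![_ * (_ / (2 * pi%:C * 'i))]mulrC !divfK ?two_pi_i_neq0 // !rmorphB /=.
rewrite !(mulrBr (2 * pi%:C * 'i)) (subr_swap E12) (subr_swap E1) (subr_swap E2).
by field.
Qed.
End Symbols.
End Cocycles.

Theorem proposition3 (R : realType) (G : set 'M[R]_2) (f : R[i] -> R[i])
    (a : option R) (sigma : 'M[R]_2) (S Sstar : 'M[R]_2 -> R)
    (fuchsian_G : fuchsian_first_kind G)
    (finite_volume_G : (covolume G < +oo)%E)
    (cusp_infty : is_cusp G None)
    (scaling_infty : scaling_matrix G None 1%:M)
    (cusp_form_f : cusp_form2 G f)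
    (f_neq0 : exists2 z, upper_half_plane z & f z != 0)
    (cusp_a : is_cusp G a)
    (scaling_a : scaling_matrix G a sigma)
    (symbol_S : modular_dedekind_symbol G f a sigma S)
    (symbol_Sstar : higher_dedekind_symbol G f a sigma Sstar) :
  let theta := fun g : 'M[R]_2 => Sstar g - S g in
  [/\ forall g1 g2 g3, G g1 -> G g2 -> G g3 ->
        (Sstar (g1 *m g2 *m g3) - Sstar (g1 *m g2) - Sstar (g1 *m g3)
         - Sstar (g2 *m g3) + Sstar g1 + Sstar g2 + Sstar g3)%:C
        = omega (g1 *m g2) g3 - omega g1 g3 - omega g2 g3,
      forall g1 g2, G g1 -> G g2 ->
        eq_mod1 (S (g1 *m g2)) (S g1 + S g2),
      forall g1 g2 g3, G g1 -> G g2 -> G g3 ->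
        eq_mod1 (Sstar (g1 *m g2 *m g3))
          (Sstar (g1 *m g2) + Sstar (g1 *m g3) + Sstar (g2 *m g3)
           - Sstar g1 - Sstar g2 - Sstar g3)
    & forall g1 g2 g3, G g1 -> G g2 -> G g3 ->
        theta (g1 *m g2 *m g3)
        = theta (g1 *m g2) + theta (g1 *m g3) + theta (g2 *m g3)
          - theta g1 - theta g2 - theta g3].
Proof.
move=> theta.
have detG := fuchsian_det fuchsian_G.
have GM := fuchsian_mul fuchsian_G.
have cS M N : G M -> G N -> (S (M *m N) - S M - S N)%:C = omega M N.
  exact: (dedekind_cocycle fuchsian_G symbol_S).
pose B M N := period_pairing (V_f G f) (modular_symbol f M) (modular_symbol f N).
have cT M N : G M -> G N ->
    (Sstar (M *m N) - Sstar M - Sstar N)%:C = omega M N + B M N.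
  exact: (higher_dedekind_cocycle fuchsian_G cusp_form_f cusp_infty scaling_infty
    cusp_a scaling_a symbol_Sstar).
have BDl M N K : G M -> G N -> B (M *m N) K = B M K + B N K.
  move=> GM' GN'; rewrite /B -period_pairingDl.
  by rewrite (modular_symbolM detG cusp_form_f cusp_infty scaling_infty GM' GN').
(* the pairing is additive in its first argument, so it drops out *)
have main g1 g2 g3 : G g1 -> G g2 -> G g3 ->
  (Sstar (g1 *m g2 *m g3) - Sstar (g1 *m g2) - Sstar (g1 *m g3)
         - Sstar (g2 *m g3) + Sstar g1 + Sstar g2 + Sstar g3)%:C
        = omega (g1 *m g2) g3 - omega g1 g3 - omega g2 g3.
  move=> G1 G2 G3.
  have -> : omega (g1 *m g2) g3 - omega g1 g3 - omega g2 g3 =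
      (omega (g1 *m g2) g3 + B (g1 *m g2) g3)
      - (omega g1 g3 + B g1 g3) - (omega g2 g3 + B g2 g3) by rewrite BDl //; ring.
  rewrite -(cT _ _ (GM _ _ G1 G2) G3) -(cT _ _ G1 G3) -(cT _ _ G2 G3) -!rmorphB.
  by congr (_%:C); ring.
have oint M N : G M -> G N -> exists k : int, omega M N = k%:~R.
  by move=> /detG Md /detG Nd; exact: omega_int.
split=> // [g1 g2 G1 G2|g1 g2 g3 G1 G2 G3|g1 g2 g3 G1 G2 G3].
- have [k ok] := oint _ _ G1 G2.
  by apply: (@real_int _ _ k); rewrite -ok -cS // opprD addrA.
- have [k1 o1] := oint _ _ (GM _ _ G1 G2) G3.
  have [k2 o2] := oint _ _ G1 G3.
  have [k3 o3] := oint _ _ G2 G3.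
  apply: (@real_int _ _ (k1 - k2 - k3)); rewrite 2!intrB -o1 -o2 -o3 -main //.
  by congr (_%:C); ring.
(* the phase factors of the two cocycles cancel, and the pairing remains *)
have cth M N : G M -> G N -> (theta (M *m N) - theta M - theta N)%:C = B M N.
  move=> GM' GN'; rewrite -[RHS](addKr (omega M N)) -(cT _ _ GM' GN') -(cS _ _ GM' GN').
  by rewrite -rmorphN -rmorphD; congr (_%:C); rewrite /theta; ring.
have : (theta (g1 *m g2 *m g3) - theta (g1 *m g2) - theta g3)%:C =
   ((theta (g1 *m g3) - theta g1 - theta g3) + (theta (g2 *m g3) - theta g2 - theta g3))%:C.
  rewrite (cth _ _ (GM _ _ G1 G2) G3) (BDl _ _ _ G1 G2).
  by rewrite -(cth _ _ G1 G3) -(cth _ _ G2 G3) -rmorphD.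
by move=> /complexI; lra.
Qed.
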